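(* Consider the following adversarial linear contextual bandit game with off-policy feedback. There is a context space $\mathcal{X}$, a finite action set $\mathcal{A}$ of size $K$, and a known feature map $\varphi:\mathcal{X}\times\mathcal{A}\to\mathbb{R}^d$. In each round $t=1,\dots,n$: the adversary chooses $\theta_t\in\mathbb{R}^d$ depending only on the past (not on $X_t$ or $A_t$), such that the rewards $r_t(x,a)=\langle\theta_t,\varphi(x,a)\rangle$ lie in $[0,1]$ for all $(x,a)$; a context $X_t$ is drawn i.i.d. from a fixed distribution on $\mathcal{X}$ and revealed to the learner; the learner picks $A_t\in\mathcal{A}$; an action $A^B_t\sim\pi_B(\cdot\mid X_t)$ is drawn from a fixed behavior policy $\pi_B:\mathcal{X}\to\Delta_{\mathcal{A}}$; the learner observes $R^B_t=r_t(X_t,A^B_t)$ and $\varphi(X_t,A^B_t)$ (but not its own reward). For a policy $\pi:\mathcal{X}\to\Delta_{\mathcal{A}}$ let $\overline V(\pi)=\mathbb{E}\big[\sum_a\pi(a\mid X)\varphi(X,a)\varphi(X,a)^\top\big]$ with $X$ drawn from the context distribution. Assume $\overline V(\pi_B)$ is known to the learner and invertible. The learner runs LinProd with learning rate $\eta>0$: it sets $\hat\theta_t=\overline V(\pi_B)^{-1}\varphi(X_t,A^B_t)R^B_t$, and in round $t$ draws $A_t$ from $$\pi_t(a\mid X_t)=\frac{w_t(X_t,a)}{\sum_{a'}w_t(X_t,a')},\qquad w_t(x,a)=\prod_{k=1}^{t-1}\big(1+\eta\langle\hat\theta_k,\varphi(x,a)\rangle\big).$$ Suppose $\lambda_{\min}(\overline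 V(\pi_B))\ge 2\eta\sup_{x,a}\|\varphi(x,a)\|_2^2$. Then for any comparator policy $\pi^*:\mathcal{X}\to\Delta_{\mathcal{A}}$, the regret $\mathcal{R}(\pi^* )=\sum_{t=1}^n\sum_a(\pi^*(a\mid X_t)-\pi_t(a\mid X_t))r_t(X_t,a)$ satisfies $$\mathbb{E}[\mathcal{R}(\pi^* )]\le\frac{\log K}{\eta}+\eta\, n\, C_\varphi(\pi^*;\pi_B),\qquad C_\varphi(\pi^*;\pi_B)=\mathrm{Tr}\big[\overline V(\pi_B)^{-1}\overline V(\pi^* )\big].$$ In particular, if $n$ is large enough that the condition on $\eta$ holds, then setting $\eta=\sqrt{\log K/n}$ gives $\mathbb{E}[\mathcal{R}(\pi^* )]\le\sqrt{n\log K}\,(1+C_\varphi(\pi^*;\pi_B))$, and setting $\eta=\sqrt{\log K/(C_\varphi(\pi^*;\pi_B)n)}$ gives $\mathbb{E}[\mathcal{R}(\pi^* )]\le 2\sqrt{C_\varphi(\pi^*;\pi_B)\,n\log K}$.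
   Context: $\Delta_{\mathcal{A}}$ is the set of probability distributions on $\mathcal{A}$; $\lambda_{\min}$ denotes the smallest eigenvalue and $\mathrm{Tr}$ the trace. $\pi_t(\cdot\mid x)$ is the learner's policy in round $t$, determined by past observations. The expectation is over all randomness of contexts, actions and adversary. *)

(* Defs.v *)
From HB Require Import structures.
From mathcomp Require Import all_boot all_order all_algebra.
From mathcomp Require Import all_classical all_reals all_analysis.

Set Implicit Arguments.
Unset Strict Implicit.
Unset Printing Implicit Defensive.

Import Order.TTheory GRing.Theory Num.Theory.
Import numFieldNormedType.Exports.

Local Open Scope classical_set_scope.
Local Open Scope ring_scope.

Section LinProd.
Variables (R : realType) (d : nat).

Definition dotv (u v : 'cV[R]_d) : R := \sum_i u i 0 * v i 0.
Definition sqnorm (v : 'cV[R]_d) : R := \sum_i v i 0 ^+ 2.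

Definition lambda_min_ge (M : 'M[R]_d) (c : R) : Prop :=
  forall l : R, eigenvalue M l -> c <= l.

Variables (dT : measure_display) (T : measurableType dT)
          (D : probability T R) (A : finType) (phi : T -> A -> 'cV[R]_d).

Definition is_policy (pi : T -> A -> R) : Prop :=
  (forall x a, 0 <= pi x a) /\ (forall x, \sum_a pi x a = 1) /\
  (forall a, measurable_fun setT (fun x => pi x a)).

Definition Vbar (pi : T -> A -> R) : 'M[R]_d :=
  \matrix_(i, j) Rintegral D setT
     (fun x => \sum_a pi x a * phi x a i 0 * phi x a j 0).

Definition Cphi (pistar piB : T -> A -> R) : R :=
  \tr (invmx (Vbar piB) *m Vbar pistar).

(* A history is the sequence of past rounds (X_s, A^B_s, A_s), oldest first.
   The adversary may be randomized: it draws a seed u : U (from a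
   probability space independent of everything else) and then chooses
   theta_t = adv u h, where h is the history of rounds 1..t-1. *)
Definition hist := seq (T * A * A).

Variables (dU : measure_display) (U : measurableType dU)
          (adv : U -> hist -> 'cV[R]_d) (piB pistar : T -> A -> R) (eta : R).

Definition reward (u : U) (h : hist) (x : T) (a : A) : R :=
  dotv (adv u h) (phi x a).

(* thetahat_k = Vbar(piB)^-1 phi(X_k, A^B_k) R^B_k   (k is 0-based here,
   i.e. the (k+1)-th round of the history h) *)
Definition thetahat (u : U) (h : hist) (k : nat) : 'cV[R]_d :=
  match drop k h with
  | (x, b, _) :: _ =>
      reward u (take k h) x b *: (invmx (Vbar piB) *m phi x b)
  | [::] => 0
  end.

Definition weight (u : U) (h : hist) (x : T) (a : A) : R :=
  \prod_(k < size h) (1 + eta * dotv (thetahat u h k) (phi x a)).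

Definition pi_learn (u : U) (h : hist) (x : T) (a : A) : R :=
  weight u h x a / \sum_a' weight u h x a'.

Definition inst_regret (u : U) (h : hist) (x : T) : R :=
  \sum_a (pistar x a - pi_learn u h x a) * reward u h x a.

(* Expected sum of the instantaneous regrets of the next m rounds, given
   the adversary seed u and the current history h:
   X ~ D, A^B ~ piB(.|X), A ~ pi_t(.|X) (independently). *)
Fixpoint exp_regret_from (u : U) (m : nat) (h : hist) : R :=
  match m with
  | 0 => 0
  | m'.+1 =>
      Rintegral D setT (fun x =>
        \sum_b piB x b * \sum_a pi_learn u h x a *
           (inst_regret u h x + exp_regret_from u m' (rcons h (x, b, a))))
  end.

End LinProd.

Definition expected_regret (R : realType) (d : nat) (dT : measure_display)
  (T : measurableType dT) (D : probability T R) (A : finType)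
  (phi : T -> A -> 'cV[R]_d) (dU : measure_display) (U : measurableType dU)
  (Q : probability U R) (adv : U -> hist T A -> 'cV[R]_d)
  (piB pistar : T -> A -> R) (eta : R) (n : nat) : R :=
  Rintegral Q setT
    (fun u => exp_regret_from D phi adv piB pistar eta u n [::]).

Definition mkhist (dT : measure_display) (T : measurableType dT) (A : finType)
  (xs : seq T) (ba : seq (A * A)) : hist T A :=
  [seq ((z.1, z.2.1), z.2.2) | z <- zip xs ba].

Definition eta_condition (R : realType) (d : nat) (dT : measure_display)
  (T : measurableType dT) (D : probability T R) (A : finType)
  (phi : T -> A -> 'cV[R]_d) (piB : T -> A -> R) (eta : R) : Prop :=
  forall x a, lambda_min_ge (Vbar D phi piB) (2 * eta * sqnorm (phi x a)).

(* Main.v *)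
(* Let [x'] be a ghost context, independent of the game.  The potential
   [1/eta * E_x' (ln (sum_a w(x',a)) - sum_a pistar(a|x') ln w(x',a))]
   starts at [ln K / eta] and stays nonnegative.  The eigenvalue condition
   forces [|eta <thetahat, phi>| <= 1/2], so [z - z^2 <= ln (1 + z) <= z]
   applies to each factor of the weights.  As [thetahat] is unbiased given the
   past, one round lowers the expected potential by at least its expected
   regret, up to the second-moment term
   [eta * E (thetahat^T Vbar(pistar) thetahat)], which is at most [eta * C]
   because rewards lie in [0,1].  The bound follows by induction on the number
   of remaining rounds. *)
Require Import Defs.
From HB Require Import structures.
From mathcomp Require Import all_boot all_order all_algebra.
From mathcomp Require Import all_classical all_reals all_analysis.
From mathcomp Require Import measurable_realfun ring lra.
From mathcomp Require complex.
Import Order.TTheory GRing.Theory Num.Theory.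
Import numFieldNormedType.Exports.
Local Open Scope classical_set_scope.
Local Open Scope ring_scope.

Set Implicit Arguments.
Unset Strict Implicit.
Unset Printing Implicit Defensive.

(** * Eigenvalue bounds for real quadratic forms, by complex diagonalization *)

Section Spectral.
Local Open Scope sesquilinear_scope.

Lemma unitary_sqnorm (C : numClosedFieldType) d (P : 'M[C]_d) (v : 'cV[C]_d) :
  P \is unitarymx -> \sum_i `|(P *m v) i 0| ^+ 2 = \sum_i `|v i 0| ^+ 2.
Proof.
move=> Pu; have E (w : 'cV[C]_d) : \sum_i `|w i 0| ^+ 2 = (w ^t* *m w) 0 0.
  by rewrite mxE; apply: eq_bigr => i _; rewrite !mxE mulrC -normCK.
rewrite !E trmx_mul map_mxM mulmxA -[_ *m _ *m P]mulmxA.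
by rewrite -invmx_unitary// mulVmx ?mulmx1// unitarymx_unit.
Qed.

Lemma normal_quadratic_form (C : numClosedFieldType) d (M : 'M[C]_d)
    (v : 'cV[C]_d) : M \is normalmx ->
  (v ^t* *m (M *m v)) 0 0 =
  \sum_i spectral_diag M 0 i * `|(spectralmx M *m v) i 0| ^+ 2.
Proof.
move=> Mn; set P := spectralmx M; have Pu := spectral_unitarymx M.
rewrite {1}(orthomx_spectralP Mn) -/P invmx_unitary// -!mulmxA !mulmxA.
rewrite -map_mxM -trmx_mul -!mulmxA.
rewrite mxE; apply: eq_bigr => i _.
by rewrite mul_diag_mx !mxE normCK mulrCA [X in _ * X]mulrC.
Qed.

(** Row [i] of the spectral matrix is a left eigenvector, which is the convention of [eigenvalue];
    it is nonzero because the matrix is invertible. *)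
Lemma spectral_diag_eigenvalue (C : numClosedFieldType) d (M : 'M[C]_d) i :
  M \is normalmx -> eigenvalue M (spectral_diag M 0 i).
Proof.
move=> Mn; have Pu := spectral_unit M; have ME := orthomx_spectralP Mn.
apply/eigenvalueP; exists (row i (spectralmx M)).
  have -> : spectral_diag M 0 i *: row i (spectralmx M) =
      row i (diag_mx (spectral_diag M) *m spectralmx M).
    by apply/rowP => j; rewrite mul_diag_mx !mxE.
  move: ME; set P := spectralmx M; set s := spectral_diag M => ME.
  by rewrite [X in _ *m X]ME -row_mul !mulmxA mulmxV// mul1mx.
apply/eqP => r0; have := congr1 (mulmx^~ (invmx (spectralmx M))) r0.
rewrite -row_mul mulmxV// mul0mx => /rowP/(_ i); rewrite !mxE eqxx => /eqP.
by rewrite oner_eq0.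
Qed.

End Spectral.

(** Over [R[i]] a real symmetric matrix is hermitian, so a unitary change of basis turns both sides
    into weighted sums of the same squared moduli, compared term by term. The spectral entries are
    real, hence come from eigenvalues of [M] over [R], to which the hypothesis applies. *)
Lemma lambda_min_quadratic_form (R : realType) d (M : 'M[R]_d) c
    (v : 'cV[R]_d) :
  M^T = M -> lambda_min_ge M c -> c * sqnorm v <= dotv v (M *m v).
Proof.
Import complex.
move=> Msym Mc; pose f : {rmorphism R -> R[i]} := real_complex R.
have Mreal m n (N : 'M[R]_(m, n)) : map_mx f N \is a mxOver Num.real.
  by apply/mxOverP => i j; rewrite mxE; apply/complex_realP; exists (N i j).
have Mh : map_mx f M \is hermsymmx.
  apply: realsym_hermsym => //; apply/is_hermitianmxP.
  by rewrite expr0 scale1r map_mx_id// map_trmx Msym.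
have Mn := hermitian_normalmx Mh.
have Cv (w : R) : `|f w| ^+ 2 = f (w ^+ 2).
  by rewrite real_normK ?rmorphXn//; apply/complex_realP; exists w.
have Esq : f (sqnorm v) =
    \sum_i `|(spectralmx (map_mx f M) *m map_mx f v) i 0| ^+ 2.
  rewrite unitary_sqnorm ?spectral_unitarymx// rmorph_sum.
  by apply: eq_bigr => i _; rewrite mxE Cv.
have Edot : f (dotv v (M *m v)) =
    \sum_i spectral_diag (map_mx f M) 0 i *
      `|(spectralmx (map_mx f M) *m map_mx f v) i 0| ^+ 2.
  rewrite -normal_quadratic_form// -map_mxM mxE rmorph_sum.
  apply: eq_bigr => i _; rewrite rmorphM realmxC.
    by rewrite !mxE.
  by rewrite map_trmx.
rewrite -lecR -/(f _) -/(f _) rmorphM Esq Edot mulr_sumr.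
apply: ler_sum => i _; apply: ler_wpM2r; first by rewrite exprn_ge0.
have := @spectral_diag_eigenvalue _ _ _ i Mn.
have /mxOverP/(_ 0 i)/complex_realP[l ->] := hermitian_spectral_diag_real Mh.
by rewrite (eigenvalue_map f) => /Mc; rewrite lecR.
Qed.

(** * Monotonicity of the integral on arbitrary functions *)

Section LowerIntegral.
Context d (T : measurableType d) (R : realType).
Variable mu : {measure set T -> \bar R}.

Import HBNNSimple.

(* [integral] is a difference of suprema over simple functions, hence monotone
   on arbitrary functions.  This lets the backward recursion of the regret be
   bounded without showing that it is measurable in the observed context. *)
Lemma le_integral_arbitrary (f g : T -> \bar R) : (forall x, f x <= g x)%E ->
  (\int[mu]_x f x <= \int[mu]_x g x)%E.
Proof.
move=> fg; rewrite /integral !patch_setT; apply: leeB.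
  apply: ge_ereal_sup => _ [h hf <-]; apply: ereal_sup_ubound; exists h => // x.
  by apply: le_trans (hf x) _; apply: (@funepos_le _ _ setT) => //; rewrite inE.
apply: ge_ereal_sup => _ [h hf <-]; apply: ereal_sup_ubound; exists h => // x.
by apply: le_trans (hf x) _; apply: (@funeneg_le _ _ setT) => //; rewrite inE.
Qed.

End LowerIntegral.

(** * Expectations of bounded measurable functions *)

Section Prob.
Context d (T : measurableType d) (R : realType) (P : probability T R).
Implicit Types f g : T -> R.

(** This class is closed under the operations that build the potential and is integrable under any
    probability, so linearity of the expectation holds throughout it. *)
Definition bmeas f := measurable_fun setT f /\ exists B, forall x, `|f x| <= B.

Lemma Rintegral_cstP (r : R) : Rintegral P setT (fun=> r) = r.
Proof.
rewrite Rintegral_cst//; set p := (X in fine X).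
by have -> : p = 1%E; [exact: probability_setT|rewrite mulr1].
Qed.

(** [Rintegral] applies [fine], which is monotone only on finite values. The constants [l] and [u]
    trap both integrals, so finiteness follows from monotonicity alone. *)
Lemma le_Rintegral_bounded f g (l u : R) :
  (forall x, l <= f x) -> (forall x, f x <= g x) -> (forall x, g x <= u) ->
  Rintegral P setT f <= Rintegral P setT g.
Proof.
move=> lf fg gu.
have icst (r : R) : (\int[P]_x r%:E)%E = r%:E.
  rewrite integral_cst//; set p := (X in (_ * X)%E).
  by have -> : p = 1%E; [exact: probability_setT|rewrite mule1].
have fin h : (forall x, l <= h x) -> (forall x, h x <= u) ->
    (\int[P]_x (h x)%:E)%E \is a fin_num.
  move=> lh hu; rewrite fin_numE; apply/andP; split.
    rewrite -ltNye; apply: (@lt_le_trans _ _ l%:E); first exact: ltNyr.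
    by rewrite -icst; apply: le_integral_arbitrary => x; rewrite lee_fin.
  rewrite -ltey; apply: (@le_lt_trans _ _ u%:E); last exact: ltry.
  by rewrite -icst; apply: le_integral_arbitrary => x; rewrite lee_fin.
apply: fine_le.
- by apply: fin => // x; apply: le_trans (fg x) _.
- by apply: fin => // x; apply: le_trans (fg x).
- by apply: le_integral_arbitrary => x; rewrite lee_fin.
Qed.

Lemma bmeas_integrable f : bmeas f -> P.-integrable setT (EFin \o f).
Proof.
move=> [mf [B fB]]; apply: measurable_bounded_integrable => //.
  by rewrite (le_lt_trans (probability_le1 _ _))// ltry.
exists B; split; first exact: num_real.
by move=> M BM x _; apply: le_trans (fB x) _; apply: ltW.
Qed.

Lemma bmeas_cst (r : R) : bmeas (fun=> r).
Proof. by split; [exact: measurable_cst|exists `|r|]. Qed.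

Lemma bmeasD f g : bmeas f -> bmeas g -> bmeas (fun x => f x + g x).
Proof.
move=> [mf [B fB]] [mg [C gC]]; split; first exact: measurable_funD.
by exists (B + C) => x; apply: le_trans (ler_normD _ _) _; apply: lerD.
Qed.

Lemma bmeasM f g : bmeas f -> bmeas g -> bmeas (fun x => f x * g x).
Proof.
move=> [mf [B fB]] [mg [C gC]]; split; first exact: measurable_funM.
by exists (B * C) => x; rewrite normrM; apply: ler_pM.
Qed.

Lemma bmeasN f : bmeas f -> bmeas (fun x => - f x).
Proof.
move=> bf; under eq_fun do rewrite -mulN1r.
by apply: bmeasM => //; exact: bmeas_cst.
Qed.

Lemma bmeasB f g : bmeas f -> bmeas g -> bmeas (fun x => f x - g x).
Proof. by move=> bf bg; apply: bmeasD => //; apply: bmeasN. Qed.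

Lemma bmeas_sum I (s : seq I) (F : I -> T -> R) :
  (forall i, bmeas (F i)) -> bmeas (fun x => \sum_(i <- s) F i x).
Proof.
move=> bF; elim: s => [|i s ih].
  by under eq_fun do rewrite big_nil; exact: bmeas_cst.
by under eq_fun do rewrite big_cons; exact: bmeasD.
Qed.

Lemma Rintegral_bmeasD f g : bmeas f -> bmeas g ->
  Rintegral P setT (fun x => f x + g x) =
  Rintegral P setT f + Rintegral P setT g.
Proof. by move=> bf bg; rewrite RintegralD//; exact: bmeas_integrable. Qed.

Lemma Rintegral_bmeasZ (r : R) f : bmeas f ->
  Rintegral P setT (fun x => r * f x) = r * Rintegral P setT f.
Proof. by move=> bf; rewrite RintegralZl//; exact: bmeas_integrable. Qed.

Lemma Rintegral_bmeas_sum I (s : seq I) (F : I -> T -> R) :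
  (forall i, bmeas (F i)) ->
  Rintegral P setT (fun x => \sum_(i <- s) F i x) =
  \sum_(i <- s) Rintegral P setT (F i).
Proof.
move=> bF; elim: s => [|i s ih].
  by under eq_fun do rewrite big_nil; rewrite Rintegral_cstP big_nil.
under eq_fun do rewrite big_cons; rewrite big_cons -ih Rintegral_bmeasD//.
exact: bmeas_sum.
Qed.

End Prob.

(** After exponentiation the claim is [1 <= (1 + z) * expR (z ^+ 2 - z)]. For [z >= 0] the tangent
    bound on [expR] suffices, since the product becomes [1 + z ^+ 3]. For [z < 0] this falls below
    1, and a sharper polynomial bound is used. *)
Lemma ln1D_ge (R : realType) (z : R) : - 2^-1 <= z -> z - z ^+ 2 <= ln (1 + z).
Proof.
move=> hz; have z1 : 0 < 1 + z by lra.
rewrite -ler_expR lnK ?posrE//.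
have -> : z - z ^+ 2 = - (z ^+ 2 - z) by ring.
rewrite expRN -[leRHS]mulr1 -ler_pdivrMl// -invfM invf_cp1 ?mulr_gt0 ?expR_gt0//.
have [z0|z0] := leP 0 z.
  apply: (@le_trans _ _ ((1 + z) * (1 + (z ^+ 2 - z)))).
    have -> : (1 + z) * (1 + (z ^+ 2 - z)) = 1 + z ^+ 3 by ring.
    by rewrite lerDl exprn_ge0.
  by rewrite ler_pM2l// expR_ge1Dx.
have pow8 (t : R) : 0 <= t ->
    1 + 8 * t + 28 * t ^+ 2 + 56 * t ^+ 3 <= (1 + t) ^+ 8.
  move=> t0; rewrite -subr_ge0.
  have -> : (1 + t) ^+ 8 - (1 + 8 * t + 28 * t ^+ 2 + 56 * t ^+ 3) =
    70 * t ^+ 4 + 56 * t ^+ 5 + 28 * t ^+ 6 + 8 * t ^+ 7 + t ^+ 8 by ring.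
  by rewrite !addr_ge0 ?mulr_ge0 ?exprn_ge0 ?ler0n.
pose y := - z; have y0 : 0 < y by rewrite /y; lra.
have y1 : y <= 2^-1 by rewrite /y; lra.
have y2 : 0 < 1 - y by lra.
(* [expR s >= (1 + s / 8) ^+ 8], whose first four binomial terms suffice here *)
pose s := y + y ^+ 2.
have -> : z ^+ 2 - z = 8%:R * (s / 8) by rewrite /s /y; field.
have -> : 1 + z = 1 - y by rewrite /y; ring.
rewrite expRM_natl; apply: (@le_trans _ _ ((1 - y) * (1 + s / 8) ^+ 8)).
  set t := s / 8; have t0 : 0 <= t.
    by rewrite divr_ge0// addr_ge0 ?exprn_ge0// ltW.
  apply: (@le_trans _ _ ((1 - y) * (1 + 8 * t + 28 * t ^+ 2 + 56 * t ^+ 3))).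
    (* Replacing each power of [y] by that power of 1/2 leaves the bracket in the identity below
       above 5, out of the initial 28. *)
    have yn n : y ^+ n <= 2^-1 ^+ n by rewrite lerXn2r// nnegrE ?invr_ge0// ltW.
    have := yn 2; have := yn 3; have := yn 4; have := yn 5 => h5 h4 h3 h2.
    rewrite -subr_ge0.
    have -> : (1 - y) * (1 + 8 * t + 28 * t ^+ 2 + 56 * t ^+ 3) - 1 =
      y ^+ 2 * (28 - 29 * y - 14 * y ^+ 2 - 28 * y ^+ 3 - 14 * y ^+ 4
        - 7 * y ^+ 5) / 64 by rewrite /t /s; field.
    rewrite divr_ge0// mulr_ge0 ?exprn_ge0 ?(ltW y0)//; lra.
  by rewrite ler_pM2l// pow8.
rewrite ler_pM2l//.
rewrite lerXn2r// ?nnegrE ?expR_ge0 ?expR_ge1Dx//.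
by rewrite addr_ge0// divr_ge0// addr_ge0 ?exprn_ge0// ltW.
Qed.

(** * Inner products, rank-one matrices and Cauchy-Schwarz *)

Section Dot.
Context (R : realType) (d : nat).
Implicit Types (u v w : 'cV[R]_d) (M N : 'M[R]_d).

Lemma dotvE u v : dotv u v = (u^T *m v) 0 0.
Proof. by rewrite mxE; apply: eq_bigr => i _; rewrite mxE. Qed.

Lemma dotvC u v : dotv u v = dotv v u.
Proof. by apply: eq_bigr => i _; rewrite mulrC. Qed.

Lemma dotvZl a u v : dotv (a *: u) v = a * dotv u v.
Proof. by rewrite mulr_sumr; apply: eq_bigr => i _; rewrite mxE mulrA. Qed.

Lemma dotvZr a u v : dotv u (a *: v) = a * dotv u v.
Proof. by rewrite dotvC dotvZl dotvC. Qed.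

Lemma dotv_mulmx u v M : dotv u (M *m v) = dotv (M^T *m u) v.
Proof. by rewrite !dotvE trmx_mul trmxK mulmxA. Qed.

Lemma dotv_form u M : dotv u (M *m u) = \sum_i \sum_j M i j * (u i 0 * u j 0).
Proof.
apply: eq_bigr => i _; rewrite mxE mulr_sumr; apply: eq_bigr => j _.
by rewrite mulrCA.
Qed.

Lemma dotv_outer u v w : dotv u ((v *m w^T) *m u) = dotv v u * dotv w u.
Proof.
rewrite !dotvE -!mulmxA [u^T *m _]mulmxA.
have -> : u^T *m v = (v^T *m u)^T by rewrite trmx_mul trmxK.
by rewrite [LHS]mxE big_ord1 !mxE.
Qed.

Lemma trace_outer v w M : \tr ((v *m w^T) *m M) = dotv w (M *m v).
Proof. by rewrite -mulmxA mxtrace_mulC trace_mx11 dotvE -mulmxA. Qed.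

Lemma sqnorm_ge0 v : 0 <= sqnorm v.
Proof. by apply: sumr_ge0 => i _; rewrite sqr_ge0. Qed.

Lemma sqr_coord_le v i : v i 0 ^+ 2 <= sqnorm v.
Proof.
by rewrite /sqnorm (bigD1 i)//= lerDl sumr_ge0// => j _; rewrite sqr_ge0.
Qed.

Lemma sqnormBZ a b u v : sqnorm (a *: u - b *: v) =
  a ^+ 2 * sqnorm u - 2 * a * b * dotv u v + b ^+ 2 * sqnorm v.
Proof.
rewrite /sqnorm /dotv !mulr_sumr -sumrB -big_split/=.
by apply: eq_bigr => i _; rewrite !mxE; ring.
Qed.

(** The vector [sqnorm v *: u - dotv u v *: v] has nonnegative squared norm, which factors as
    [sqnorm v] times the difference of the two sides. *)
Lemma dotv_CauchySchwarz u v : dotv u v ^+ 2 <= sqnorm u * sqnorm v.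
Proof.
have [v0|v0] := eqVneq (sqnorm v) 0.
  have -> : dotv u v = 0.
    apply: big1 => i _; have := sqr_coord_le v i; rewrite v0 => h.
    have /eqP : v i 0 ^+ 2 = 0 by apply/eqP; rewrite eq_le h sqr_ge0.
    by rewrite sqrf_eq0 => /eqP ->; rewrite mulr0.
  by rewrite v0 mulr0 expr0n.
have vp : 0 < sqnorm v by rewrite lt_def v0 sqnorm_ge0.
have := sqnorm_ge0 (sqnorm v *: u - dotv u v *: v).
have -> : sqnorm (sqnorm v *: u - dotv u v *: v) =
    sqnorm v * (sqnorm u * sqnorm v - dotv u v ^+ 2).
  by rewrite sqnormBZ; ring.
by rewrite pmulr_rge0// subr_ge0.
Qed.

(** For [z = invmx M *m u], coercivity gives [c * s * sqnorm z <= dotv z u]. Cauchy-Schwarz then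
    yields [c ^+ 2 * s * sqnorm z <= 1], and a second use of it on [dotv z v] gives the bound. *)
Lemma dotv_invmx_bound M u v (s c : R) : M \in unitmx -> 0 < c ->
  sqnorm u <= s -> sqnorm v <= s ->
  (forall w, c * s * sqnorm w <= dotv w (M *m w)) ->
  `|dotv (invmx M *m u) v| <= c^-1.
Proof.
move=> Mu c0 us vs Mc; set z := invmx M *m u.
have s0 : 0 <= s := le_trans (sqnorm_ge0 u) us.
have := Mc z; rewrite /z mulKVmx// -/z => h.
have z0 := sqnorm_ge0 z.
have b0 : 0 <= c * s * sqnorm z by rewrite !mulr_ge0// ltW.
have h2 : (c * s * sqnorm z) ^+ 2 <= sqnorm z * s.
  apply: (@le_trans _ _ (dotv z u ^+ 2)).
    by rewrite lerXn2r// nnegrE// (le_trans b0).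
  by apply: le_trans (dotv_CauchySchwarz _ _) _; apply: ler_wpM2l.
have h3 : c ^+ 2 * (s * sqnorm z) <= 1.
  (* One factor [s * sqnorm z] is cancelled from [h2], so the case where it vanishes is treated
     apart. *)
  have [sz|sz] := eqVneq (s * sqnorm z) 0; first by rewrite sz mulr0.
  have szp : 0 < s * sqnorm z by rewrite lt_def sz mulr_ge0.
  rewrite -(ler_pM2r szp) mul1r [leRHS]mulrC; apply: le_trans h2.
  by rewrite [leRHS](_ : _ = c ^+ 2 * (s * sqnorm z) * (s * sqnorm z))//; ring.
rewrite -ler_sqr ?nnegrE ?invr_ge0 ?(ltW c0)// real_normK ?num_real// exprVn.
rewrite -[leRHS]mul1r ler_pdivlMr ?exprn_gt0//; apply: le_trans h3.
rewrite mulrC ler_pM2l ?exprn_gt0//.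
apply: le_trans (dotv_CauchySchwarz _ _) _.
by rewrite mulrC ler_wpM2r.
Qed.

End Dot.

(** * Exponentials and logarithms of bounded functions *)

Section BoundedMore.
Context d (T : measurableType d) (R : realType).
Implicit Types f : T -> R.

Lemma bmeas_expR f : bmeas f -> bmeas (fun x => expR (f x)).
Proof.
move=> [mf [B fB]]; split.
  by apply: (@measurableT_comp _ _ _ _ _ _ expR) => //; exact: measurable_expR.
exists (expR B) => x; rewrite ger0_norm ?expR_ge0// ler_expR.
exact: le_trans (ler_norm _) _.
Qed.

Lemma bmeas_ln f (l u : R) : bmeas f ->
  (forall x, l <= ln (f x)) -> (forall x, ln (f x) <= u) ->
  bmeas (fun x => ln (f x)).
Proof.
move=> [mf _] lf fu; split.
  by apply: (@measurableT_comp _ _ _ _ _ _ (@ln R)) => //; exact: measurable_ln.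
exists (`|l| + `|u|) => x; rewrite ler_norml; apply/andP; split.
  apply: le_trans (lf x); rewrite lerNl; apply: (@le_trans _ _ `|l|).
    by rewrite -normrN ler_norm.
  by rewrite lerDl.
apply: le_trans (fu x) _; apply: le_trans (ler_norm _) _.
by rewrite lerDr.
Qed.

End BoundedMore.

(** * Feature covariance matrices and the eigenvalue condition *)

Section Features.
Context (R : realType) (d : nat) (dT : measure_display) (T : measurableType dT).
Context (D : probability T R) (A : finType) (phi : T -> A -> 'cV[R]_d).
Implicit Types (pi : T -> A -> R).

Lemma Vbar_sym pi : (Vbar D phi pi)^T = Vbar D phi pi.
Proof.
apply/matrixP => i j; rewrite !mxE; congr Rintegral; apply/funext => x.
by apply: eq_bigr => a _; rewrite mulrAC.
Qed.

Lemma eta_condition_quadratic_form pi (eta : R) x a v :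
  eta_condition D phi pi eta ->
  2 * eta * sqnorm (phi x a) * sqnorm v <= dotv v (Vbar D phi pi *m v).
Proof.
by move=> H; apply: lambda_min_quadratic_form (H x a); exact: Vbar_sym.
Qed.

(** Testing the quadratic form on a coordinate vector bounds [2 * eta * sqnorm (phi x a)] by one
    diagonal entry of the covariance. In dimension 0 there is no such vector, but all norms are
    0. *)
Lemma eta_condition_bounded pi (eta : R) : 0 < eta ->
  eta_condition D phi pi eta -> exists s, forall x a, sqnorm (phi x a) <= s.
Proof.
move=> eta0 H; have [i _|no] := pickP 'I_d; last first.
  by exists 0 => x a; rewrite /sqnorm big1// => i; have := no i.
pose e : 'cV[R]_d := delta_mx i 0.
have e1 : sqnorm e = 1.
  rewrite /sqnorm (bigD1 i)//= big1 ?mxE ?eqxx ?expr1n ?addr0// => j /negPf ji.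
  by rewrite mxE ji expr0n.
exists (dotv e (Vbar D phi pi *m e) / (2 * eta)) => x a.
rewrite ler_pdivlMr ?mulr_gt0// mulrC.
by have := eta_condition_quadratic_form x a e H; rewrite e1 mulr1.
Qed.

(** The larger of the two squared feature norms serves as a common [s], since the eigenvalue
    condition holds at both points; the constant [c] is [2 * eta]. *)
Lemma dotv_invmx_Vbar_bound pi (eta : R) x a x' a' : 0 < eta ->
  Vbar D phi pi \in unitmx -> eta_condition D phi pi eta ->
  `|dotv (invmx (Vbar D phi pi) *m phi x a) (phi x' a')| <= (2 * eta)^-1.
Proof.
move=> eta0 Vu H; pose s := Num.max (sqnorm (phi x a)) (sqnorm (phi x' a')).
apply: (@dotv_invmx_bound _ _ _ _ _ s) => //.
- by rewrite mulr_gt0.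
- by rewrite /s le_max lexx.
- by rewrite /s le_max lexx orbT.
- by move=> w; rewrite /s maxEle; case: ifP => _;
    exact: eta_condition_quadratic_form.
Qed.

Hypothesis mphi : forall a i, measurable_fun setT (fun x => phi x a i 0).
Hypothesis bphi : exists s, forall x a, sqnorm (phi x a) <= s.

Lemma bmeas_phi a i : bmeas (fun x => phi x a i 0).
Proof.
split; first exact: mphi.
(* The bound is on squares: a coordinate of modulus [y] has either [y <= 1] or
   [y <= y ^+ 2 <= s]. *)
have [s sP] := bphi; exists (s + 1) => x.
have := le_trans (sqr_coord_le (phi x a) i) (sP x a).
rewrite -real_normK ?num_real//; move: (normr_ge0 (phi x a i 0)).
set y := `|_|; move=> y0 ys; have [y1|y1] := leP y 1.
  by apply: le_trans y1 _; rewrite lerDr (le_trans _ ys)// sqr_ge0.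
apply: (@le_trans _ _ s); last by rewrite lerDl.
by apply: le_trans ys; rewrite expr2 ler_peMl// ltW.
Qed.

Lemma policy_le1 pi x a : is_policy pi -> pi x a <= 1.
Proof.
move=> [p0 [p1 _]]; rewrite -(p1 x) (bigD1 a)//= lerDl.
by apply: sumr_ge0 => b _; exact: p0.
Qed.

Lemma bmeas_policy pi a : is_policy pi -> bmeas (fun x => pi x a).
Proof.
move=> pP; have [p0 [_ pm]] := pP; split; first exact: pm.
by exists 1 => x; rewrite ger0_norm// policy_le1.
Qed.

Lemma bmeas_dotv (f g : T -> 'cV[R]_d) :
  (forall i, bmeas (fun x => f x i 0)) ->
  (forall i, bmeas (fun x => g x i 0)) ->
  bmeas (fun x => dotv (f x) (g x)).
Proof. by move=> bf bg; apply: bmeas_sum => i; apply: bmeasM. Qed.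

Lemma bmeas_mulmx (M : 'M[R]_d) (f : T -> 'cV[R]_d) :
  (forall i, bmeas (fun x => f x i 0)) ->
  forall i, bmeas (fun x => (M *m f x) i 0).
Proof.
move=> bf i; under eq_fun do rewrite mxE.
by apply: bmeas_sum => j; apply: bmeasM => //; exact: bmeas_cst.
Qed.

(** Entrywise linearity of the expectation; symmetry of the covariance matches the index order of
    the trace. *)
Lemma Rintegral_form pi (M : 'M[R]_d) : is_policy pi ->
  Rintegral D setT (fun x => \sum_a pi x a * dotv (phi x a) (M *m phi x a)) =
  \tr (M *m Vbar D phi pi).
Proof.
move=> pP; have bpp i j :
    bmeas (fun x => \sum_a pi x a * phi x a i 0 * phi x a j 0).
  apply: bmeas_sum => a; apply: bmeasM; last exact: bmeas_phi.
  by apply: bmeasM; [exact: bmeas_policy|exact: bmeas_phi].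
transitivity (\sum_i \sum_j M i j * Vbar D phi pi i j); last first.
  apply: eq_bigr => i _; rewrite mxE; apply: eq_bigr => j _.
  by rewrite -[in RHS]Vbar_sym [in RHS]mxE.
transitivity (Rintegral D setT (fun x =>
   \sum_i \sum_j M i j * (\sum_a pi x a * phi x a i 0 * phi x a j 0))).
  congr Rintegral; apply/funext => x.
  under eq_bigr do rewrite dotv_form mulr_sumr.
  rewrite exchange_big/=; apply: eq_bigr => i _.
  under eq_bigr do rewrite mulr_sumr.
  rewrite exchange_big/=; apply: eq_bigr => j _.
  by rewrite mulr_sumr; apply: eq_bigr => a _; ring.
rewrite Rintegral_bmeas_sum => [|i]; last first.
  by apply: bmeas_sum => j; apply: bmeasM => //; exact: bmeas_cst.
apply: eq_bigr => i _; rewrite Rintegral_bmeas_sum => [|j]; last first.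
  by apply: bmeasM => //; exact: bmeas_cst.
by apply: eq_bigr => j _; rewrite Rintegral_bmeasZ// mxE.
Qed.

(** The previous identity for the rank-one matrix [u *m v^T]. *)
Lemma Rintegral_bilinear pi (u v : 'cV[R]_d) : is_policy pi ->
  Rintegral D setT (fun x =>
    \sum_a pi x a * (dotv u (phi x a) * dotv v (phi x a))) =
  dotv v (Vbar D phi pi *m u).
Proof.
move=> pP; rewrite -trace_outer -Rintegral_form//; congr Rintegral.
by apply/funext => x; apply: eq_bigr => a _; rewrite dotv_outer.
Qed.

Lemma Vbar_psd pi v : is_policy pi -> 0 <= dotv v (Vbar D phi pi *m v).
Proof.
move=> pP; rewrite -Rintegral_bilinear//; apply: Rintegral_ge0 => x _.
apply: sumr_ge0 => a _; rewrite mulr_ge0//; first by case: pP.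
by rewrite -expr2 sqr_ge0.
Qed.

End Features.

Lemma convex_comb_bounds (R : realType) (A : finType) (p f : A -> R) (l u : R) :
  (forall a, 0 <= p a) -> \sum_a p a = 1 -> (forall a, l <= f a <= u) ->
  l <= \sum_a p a * f a <= u.
Proof.
move=> p0 p1 fb; have E (c : R) : c = \sum_a p a * c.
  by rewrite -mulr_suml p1 mul1r.
rewrite [in X in X && _](E l) [in X in _ && X](E u).
apply/andP; split; apply: ler_sum => a _; apply: ler_wpM2l => //;
  by have /andP[] := fb a.
Qed.

(** * The game for a fixed adversary seed *)

Section Game.
Context (R : realType) (d : nat) (dT : measure_display) (T : measurableType dT).
Context (D : probability T R) (A : finType) (phi : T -> A -> 'cV[R]_d).
Context (dU : measure_display) (U : measurableType dU).
Context (adv : U -> hist T A -> 'cV[R]_d) (piB pistar : T -> A -> R) (eta : R).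
Context (u : U).

Hypothesis mphi : forall a i, measurable_fun setT (fun x => phi x a i 0).
Hypothesis adv01 : forall h x a, 0 <= dotv (adv u h) (phi x a) <= 1.
Hypothesis polB : is_policy piB.
Hypothesis polS : is_policy pistar.
Hypothesis Vu : Vbar D phi piB \in unitmx.
Hypothesis eta0 : 0 < eta.
Hypothesis etac : eta_condition D phi piB eta.

Implicit Types (h : hist T A) (x : T) (a b : A).

Local Notation V := (Vbar D phi piB).
Local Notation VS := (Vbar D phi pistar).
Local Notation r := (reward phi adv u).
Local Notation th := (thetahat D phi adv piB u).
Local Notation w := (weight D phi adv piB eta u).
Local Notation pil := (pi_learn D phi adv piB eta u).
Local Notation inst := (inst_regret D phi adv piB pistar eta u).
Local Notation W h x := (\sum_a w h x a).

(** The value of [thetahat] contributed by a new round after [h], freed from indexing into the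
    history. *)
Definition estimate h x b : 'cV[R]_d := r h x b *: (invmx V *m phi x b).

Lemma bounded_features : exists s, forall x a, sqnorm (phi x a) <= s.
Proof. exact: eta_condition_bounded eta0 etac. Qed.
#[local] Hint Resolve bounded_features : core.

Lemma bmeas_feature a i : bmeas (fun x => phi x a i 0).
Proof. exact: (bmeas_phi mphi bounded_features). Qed.
#[local] Hint Resolve bmeas_feature : core.

(** Rewards are at most 1 and the inner product at most [(2 * eta)^-1], so [eta] cancels. The value
    1/2 is the range in which [ln1D_ge] applies. *)
Lemma estimate_bound h x b x' a :
  `|eta * dotv (estimate h x b) (phi x' a)| <= 2^-1.
Proof.
rewrite dotvZl !normrM (gtr0_norm eta0).
have /andP[r0 r1] := adv01 h x b; rewrite (ger0_norm r0).
have := dotv_invmx_Vbar_bound x b x' a eta0 Vu etac.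
move: (normr_ge0 (dotv (invmx V *m phi x b) (phi x' a))).
move: `|dotv _ _| => y y0 yb.
apply: (@le_trans _ _ (eta * (1 * (2 * eta)^-1))).
  by apply: ler_wpM2l; [exact: ltW|exact: ler_pM].
by rewrite mul1r invfM mulrCA mulfV ?gt_eqF// mulr1.
Qed.

(** * Weights along a history: recursion, positivity, boundedness *)

Lemma thetahat_rcons h z k : (k < size h)%N -> th (rcons h z) k = th h k.
Proof.
move=> kh; rewrite /thetahat drop_rcons ?(ltnW kh)//.
rewrite -[rcons h z]cats1 takel_cat ?(ltnW kh)//.
case: (drop k h) (size_drop k h) => [/=/esym/eqP|//].
by rewrite subn_eq0 leqNgt kh.
Qed.

Lemma thetahat_last h x b a : th (rcons h (x, b, a)) (size h) = estimate h x b.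
Proof.
by rewrite /thetahat drop_rcons// drop_size/= -cats1 takel_cat// take_size.
Qed.

Lemma weight_rcons h x b a x' a' :
  w (rcons h (x, b, a)) x' a' =
  w h x' a' * (1 + eta * dotv (estimate h x b) (phi x' a')).
Proof.
rewrite /weight size_rcons big_ord_recr/= thetahat_last; congr (_ * _).
by apply: eq_bigr => k _; rewrite thetahat_rcons.
Qed.

Lemma factor_gt0 h x b x' a : 0 < 1 + eta * dotv (estimate h x b) (phi x' a).
Proof.
have := estimate_bound h x b x' a; rewrite ler_norml => /andP[h1 _]; lra.
Qed.

Lemma weight_gt0 h x a : 0 < w h x a.
Proof.
elim/last_ind: h => [|h [[y b] c] ih]; first by rewrite /weight big_ord0.
by rewrite weight_rcons mulr_gt0// factor_gt0.
Qed.

(** A [finType] may be empty, but probabilities over it could then not sum to 1. *)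
Lemma action_exists x : exists a : A, true.
Proof.
have [a _|noA] := pickP A; first by exists a.
have [_ [/(_ x)/eqP + _]] := polB.
by rewrite big1 => [|a]; [rewrite eq_sym oner_eq0|have := noA a].
Qed.

Lemma total_weight_gt0 h x : 0 < W h x.
Proof.
have [a _] := action_exists x; rewrite (bigD1 a)//= ltr_pwDl ?weight_gt0//.
by apply: sumr_ge0 => b _; exact/ltW/weight_gt0.
Qed.

Lemma weight_le_total h x a : w h x a <= W h x.
Proof.
rewrite (bigD1 a)//= lerDl; apply: sumr_ge0 => b _; exact/ltW/weight_gt0.
Qed.

Lemma bmeas_estimate h b i : bmeas (fun x => estimate h x b i 0).
Proof.
under eq_fun do rewrite mxE; apply: bmeasM; last exact: bmeas_mulmx.
by apply: bmeas_dotv => // j; exact: bmeas_cst.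
Qed.

Lemma bmeas_ln_weight h a : bmeas (fun x => ln (w h x a)).
Proof.
elim/last_ind: h => [|h [[y b] c] ih].
  by under eq_fun do rewrite /weight big_ord0; exact: bmeas_cst.
under eq_fun => x.
  rewrite weight_rcons lnM ?posrE ?weight_gt0 ?factor_gt0//.
  over.
(* With [z] in [-1/2, 1/2], [z - z ^+ 2 >= -3/4] and [z <= 1/2], so -1 and 1 bound the logarithm of
   the new factor. *)
apply: bmeasD => //; apply: (@bmeas_ln _ _ _ _ (-1) 1).
- apply: bmeasD; first exact: bmeas_cst.
  apply: bmeasM; first exact: bmeas_cst.
  by apply: bmeas_dotv => // i; exact: bmeas_cst.
- move=> x; have := estimate_bound h y b x a; rewrite ler_norml => /andP[h1 h2].
  apply: le_trans (ln1D_ge _); last by rewrite -mulN1r mulN1r.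
  move: h1 h2; set z := eta * _ => h1 h2; nra.
- move=> x; have := estimate_bound h y b x a; rewrite ler_norml => /andP[h1 h2].
  by apply: le_trans (le_ln1Dx _) _; lra.
Qed.

Lemma bmeas_weight h a : bmeas (fun x => w h x a).
Proof.
have -> : (fun x => w h x a) = (fun x => expR (ln (w h x a))).
  by apply/funext => x; rewrite lnK ?posrE ?weight_gt0.
exact/bmeas_expR/bmeas_ln_weight.
Qed.

(** From below, one summand's logarithm bounds that of the total; from above, [ln y < y]. *)
Lemma bmeas_ln_total h : bmeas (fun x => ln (W h x)).
Proof.
have bW : bmeas (fun x => W h x) by apply: bmeas_sum => a; exact: bmeas_weight.
have [a _] := action_exists point.
have [_ [B wB]] := bmeas_ln_weight h a; have [_ [C WC]] := bW.
apply: (@bmeas_ln _ _ _ _ (- B) C) => // x.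
  apply: (@le_trans _ _ (ln (w h x a))).
    by have := wB x; rewrite ler_norml => /andP[].
  by rewrite ler_ln ?posrE ?weight_gt0 ?total_weight_gt0// weight_le_total.
apply: le_trans (ltW (ln_sublinear (total_weight_gt0 h x))) _.
exact: le_trans (ler_norm _) (WC x).
Qed.

(** Division by the total is written as a factor [expR (- ln W)], so the reciprocal inherits
    boundedness from the logarithm. *)
Lemma bmeas_pil h a : bmeas (fun x => pil h x a).
Proof.
have -> : (fun x => pil h x a) = (fun x => w h x a * expR (- ln (W h x))).
  apply/funext => x; rewrite /pi_learn expRN lnK ?posrE//.
  exact: total_weight_gt0.
apply: bmeasM; first exact: bmeas_weight.
by apply: bmeas_expR; apply: bmeasN; exact: bmeas_ln_total.
Qed.

Lemma pil_ge0 h x a : 0 <= pil h x a.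
Proof. by rewrite divr_ge0// ltW// ?weight_gt0 ?total_weight_gt0. Qed.

Lemma pil_sum1 h x : \sum_a pil h x a = 1.
Proof. by rewrite -mulr_suml divff// gt_eqF// total_weight_gt0. Qed.

Lemma inst_bounds h x : -1 <= inst h x <= 1.
Proof.
have [s0 [s1 _]] := polS.
have /andP[p estimate_moment] := convex_comb_bounds (s0 x) (s1 x) (adv01 h x).
have /andP[p' q'] :=
  convex_comb_bounds (pil_ge0 h x) (pil_sum1 h x) (adv01 h x).
have -> : inst h x = \sum_a pistar x a * r h x a - \sum_a pil h x a * r h x a.
  by rewrite -sumrB; apply: eq_bigr => a _; rewrite mulrBl.
rewrite /reward; apply/andP; split; lra.
Qed.

(** * The potential and its one-round change *)

Definition log_potential h x := ln (W h x) - \sum_a pistar x a * ln (w h x a).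

Lemma bmeas_log_potential h : bmeas (log_potential h).
Proof.
apply: bmeasB; first exact: bmeas_ln_total.
apply: bmeas_sum => a; apply: bmeasM; first exact: bmeas_policy.
exact: bmeas_ln_weight.
Qed.
#[local] Hint Resolve bmeas_log_potential : core.

(** As [pistar] sums to 1, [log_potential] is the cross-entropy
    [- \sum_a pistar x a * ln (pil h x a)], and no weight exceeds the total. *)
Lemma log_potential_ge0 h x : 0 <= log_potential h x.
Proof.
have [s0 [s1 _]] := polS; rewrite subr_ge0.
have -> : ln (W h x) = \sum_a pistar x a * ln (W h x).
  by rewrite -mulr_suml s1 mul1r.
apply: ler_sum => a _; rewrite ler_wpM2l// ler_ln ?posrE ?weight_gt0//.
  exact: weight_le_total.
exact: total_weight_gt0.
Qed.

(** The total weight is bounded by [ln (1 + z) <= z], with no second-order cost; only the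
    comparator's weights use [z - z ^+ 2 <= ln (1 + z)]. Hence the quadratic term is averaged under
    [pistar] and not under the learner's policy. *)
Lemma log_potential_step h x b c x' :
  log_potential (rcons h (x, b, c)) x' <= log_potential h x'
    + eta *
      (\sum_a (pil h x' a - pistar x' a) * dotv (estimate h x b) (phi x' a))
    + eta ^+ 2 * \sum_a pistar x' a *
        (dotv (estimate h x b) (phi x' a) * dotv (estimate h x b) (phi x' a)).
Proof.
set y := fun a => dotv (estimate h x b) (phi x' a).
have [s0 [s1 _]] := polS.
have yb a : - 2^-1 <= eta * y a.
  by have := estimate_bound h x b x' a; rewrite ler_norml => /andP[].
have WE : W (rcons h (x, b, c)) x' =
    W h x' * (1 + eta * \sum_a pil h x' a * y a).
  rewrite mulrDr mulr1 mulrCA !mulr_sumr -big_split/=; apply: eq_bigr => a _.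
  rewrite weight_rcons /pi_learn -/(y a) mulrDr mulr1; congr (_ + _).
  by field; rewrite gt_eqF// total_weight_gt0.
(* By [WE] this is a ratio of two positive totals. *)
have F0 : 0 < 1 + eta * \sum_a pil h x' a * y a.
  by rewrite -(pmulr_rgt0 _ (total_weight_gt0 h x')) -WE total_weight_gt0.
have lnW : ln (W (rcons h (x, b, c)) x') <=
    ln (W h x') + eta * \sum_a pil h x' a * y a.
  rewrite WE lnM ?posrE ?total_weight_gt0// lerD2l le_ln1Dx//; lra.
have lnw : \sum_a pistar x' a * ln (w h x' a) +
    \sum_a pistar x' a * (eta * y a - (eta * y a) ^+ 2) <=
    \sum_a pistar x' a * ln (w (rcons h (x, b, c)) x' a).
  rewrite -big_split; apply: ler_sum => a _ /=; rewrite -mulrDr ler_wpM2l//.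
  rewrite weight_rcons lnM ?posrE ?weight_gt0 ?factor_gt0// lerD2l.
  exact: ln1D_ge.
have -> : eta * (\sum_a (pil h x' a - pistar x' a) * y a) =
    eta * \sum_a pil h x' a * y a - \sum_a pistar x' a * (eta * y a).
  rewrite !mulr_sumr -sumrB; apply: eq_bigr => a _; ring.
have -> : eta ^+ 2 * \sum_a pistar x' a * (y a * y a) =
    \sum_a pistar x' a * (eta * y a) ^+ 2.
  by rewrite mulr_sumr; apply: eq_bigr => a _; ring.
have E : \sum_a pistar x' a * (eta * y a - (eta * y a) ^+ 2) =
  \sum_a pistar x' a * (eta * y a) - \sum_a pistar x' a * (eta * y a) ^+ 2.
  by rewrite -sumrB; apply: eq_bigr => a _; rewrite mulrBr.
rewrite E in lnw; rewrite /log_potential; lra.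
Qed.

Definition potential h := Rintegral D setT (log_potential h) / eta.

(** Expected feature of the learner minus that of the comparator. As one vector it pairs linearly
    both with the adversary's parameter and with its estimate, which lets unbiasedness cancel the
    two. *)
Definition mean_gap h : 'cV[R]_d :=
  \col_i Rintegral D setT (fun x =>
    \sum_a (pil h x a - pistar x a) * phi x a i 0).

Lemma bmeas_mean_gap h i :
  bmeas (fun x => \sum_a (pil h x a - pistar x a) * phi x a i 0).
Proof.
apply: bmeas_sum => a; apply: bmeasM => //.
by apply: bmeasB; [exact: bmeas_pil|exact: bmeas_policy].
Qed.
#[local] Hint Resolve bmeas_mean_gap : core.

Lemma mean_gapE h v (x : T) :
  \sum_a (pil h x a - pistar x a) * dotv v (phi x a) =
  \sum_i v i 0 * \sum_a (pil h x a - pistar x a) * phi x a i 0.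
Proof.
under eq_bigr do rewrite mulr_sumr; rewrite exchange_big/=.
by apply: eq_bigr => i _; rewrite mulr_sumr; apply: eq_bigr => a _; ring.
Qed.

Lemma bmeas_mean_gapv h v :
  bmeas (fun x => \sum_a (pil h x a - pistar x a) * dotv v (phi x a)).
Proof.
under eq_fun do rewrite mean_gapE.
by apply: bmeas_sum => i; apply: bmeasM => //; exact: bmeas_cst.
Qed.
#[local] Hint Resolve bmeas_mean_gapv : core.

Lemma Rintegral_gap h v :
  Rintegral D setT (fun x => \sum_a (pil h x a - pistar x a) * dotv v (phi x a))
  = dotv v (mean_gap h).
Proof.
under eq_fun do rewrite mean_gapE.
rewrite Rintegral_bmeas_sum; last first.
  by move=> i; apply: bmeasM => //; exact: bmeas_cst.
by apply: eq_bigr => i _; rewrite Rintegral_bmeasZ// mxE.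
Qed.

(** The quadratic form of the estimate with its reward replaced by 1, hence independent of the
    history. *)
Definition estimate_moment x b :=
  dotv (invmx V *m phi x b) (VS *m (invmx V *m phi x b)).

(** [log_potential_step] integrated over the ghost context and divided by [eta]: the linear term
    pairs the estimate with [mean_gap], the quadratic one becomes a form in [VS]. *)
Lemma potential_step h x b c :
  potential (rcons h (x, b, c)) <=
  potential h + dotv (estimate h x b) (mean_gap h) + eta * estimate_moment x b.
Proof.
set v := estimate h x b.
have bq : bmeas (fun x' =>
    \sum_a pistar x' a * (dotv v (phi x' a) * dotv v (phi x' a))).
  apply: bmeas_sum => a; apply: bmeasM; first exact: bmeas_policy.
  by apply: bmeasM; apply: bmeas_dotv => // i; exact: bmeas_cst.
pose f1 x' := eta * (\sum_a (pil h x' a - pistar x' a) * dotv v (phi x' a)).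
pose f2 x' := eta ^+ 2 *
  \sum_a pistar x' a * (dotv v (phi x' a) * dotv v (phi x' a)).
have bf1 : bmeas f1 by apply: bmeasM => //; exact: bmeas_cst.
have bf2 : bmeas f2 by apply: bmeasM => //; exact: bmeas_cst.
have bGf1 : bmeas (fun x' => log_potential h x' + f1 x') by exact: bmeasD.
have [_ [B HB]] := bmeasD bGf1 bf2.
have : Rintegral D setT (log_potential (rcons h (x, b, c))) <=
    Rintegral D setT (fun x' => log_potential h x' + f1 x' + f2 x').
  apply: (@le_Rintegral_bounded _ _ _ _ _ _ 0 B).
  - exact: log_potential_ge0.
  - exact: log_potential_step.
  - by move=> x'; exact: le_trans (ler_norm _) (HB x').
rewrite (Rintegral_bmeasD _ bGf1 bf2).
rewrite (Rintegral_bmeasD _ (bmeas_log_potential h) bf1).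
rewrite !Rintegral_bmeasZ// Rintegral_gap Rintegral_bilinear// => H.
have qE : dotv v (VS *m v) <= estimate_moment x b.
  have /andP[r0 r1] := adv01 h x b.
  rewrite /v /estimate -scalemxAr dotvZl dotvZr mulrA -/(estimate_moment x b).
  by rewrite ler_piMl ?Vbar_psd// mulr_ile1.
rewrite /potential ler_pdivrMr//; apply: le_trans H _.
rewrite !mulrDl divfK ?gt_eqF// [eta * dotv _ _]mulrC -!addrA !lerD2l.
have -> : eta * estimate_moment x b * eta =
    eta ^+ 2 * estimate_moment x b by ring.
by apply: ler_wpM2l => //; rewrite exprn_ge0// ltW.
Qed.

(** * Expectations over one round, and the induction on rounds *)

Lemma Rintegral_inst h :
  Rintegral D setT (inst h) = - dotv (adv u h) (mean_gap h).
Proof.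
rewrite -Rintegral_gap -mulN1r -Rintegral_bmeasZ//; congr Rintegral.
apply/funext => x; rewrite mulr_sumr; apply: eq_bigr => a _.
by rewrite /reward; ring.
Qed.

Lemma bmeas_inst h : bmeas (inst h).
Proof.
apply: bmeas_sum => a; apply: bmeasM.
  by apply: bmeasB; [exact: bmeas_policy|exact: bmeas_pil].
by apply: bmeas_dotv => // i; exact: bmeas_cst.
Qed.

(** Unbiasedness: averaging [phi phi^T] under [piB] gives [V], which the inverse in the estimate
    cancels. *)
Lemma Rintegral_estimate h v :
  Rintegral D setT (fun x => \sum_b piB x b * dotv (estimate h x b) v) =
  dotv (adv u h) v.
Proof.
transitivity (Rintegral D setT (fun x => \sum_b piB x b *
    (dotv (adv u h) (phi x b) * dotv (invmx V *m v) (phi x b)))).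
  congr Rintegral; apply/funext => x; apply: eq_bigr => b _.
  by rewrite dotvZl dotvC dotv_mulmx trmx_inv Vbar_sym.
by rewrite Rintegral_bilinear// dotv_mulmx Vbar_sym mulKVmx// dotvC.
Qed.

(** The averaged form has matrix [V^-1 VS V^-1]; its trace against [V] loses one inverse and leaves
    the coverage coefficient. *)
Lemma Rintegral_estimate_moment :
  Rintegral D setT (fun x => \sum_b piB x b * estimate_moment x b) =
  Cphi D phi pistar piB.
Proof.
rewrite /Cphi; set Vi := invmx V.
transitivity (Rintegral D setT (fun x => \sum_b piB x b *
    dotv (phi x b) ((Vi *m VS *m Vi) *m phi x b))).
  congr Rintegral; apply/funext => x; apply: eq_bigr => b _; congr (_ * _).
  rewrite -[_ *m _ *m Vi *m _]mulmxA -[Vi *m VS *m _]mulmxA [RHS]dotv_mulmx.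
  by rewrite trmx_inv Vbar_sym.
by rewrite Rintegral_form// -[_ *m Vi *m _]mulmxA /Vi mulVmx// mulmx1.
Qed.

(** The upper bound is the goal. The crude lower bound travels with it because comparing the
    recursive integrals requires integrands bounded on both sides. *)
Lemma exp_regret_from_bounds m h :
  - m%:R <= exp_regret_from D phi adv piB pistar eta u m h <=
  potential h + m%:R * (eta * Cphi D phi pistar piB).
Proof.
set C := Cphi D phi pistar piB.
elim: m h => [|m ih] h /=.
  rewrite oppr0 lexx mul0r addr0 /= divr_ge0 ?(ltW eta0)//.
  by apply: Rintegral_ge0 => x _; exact: log_potential_ge0.
have [b0 [b1 _]] := polB.
set F := fun x : T => \sum_b _.
pose K := potential h + m%:R * (eta * C).
pose f1 x := \sum_b piB x b * dotv (estimate h x b) (mean_gap h).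
pose f2 x := eta * \sum_b piB x b * estimate_moment x b.
have bf1 : bmeas f1.
  apply: bmeas_sum => b; apply: bmeasM; first exact: bmeas_policy.
  by apply: bmeas_dotv => i; [exact: bmeas_estimate|exact: bmeas_cst].
have bz b i : bmeas (fun x => (invmx V *m phi x b) i 0) by exact: bmeas_mulmx.
have bq : bmeas (fun x => \sum_b piB x b * estimate_moment x b).
  apply: bmeas_sum => b; apply: bmeasM; first exact: bmeas_policy.
  by apply: bmeas_dotv => // i; exact: bmeas_mulmx.
have bf2 : bmeas f2 by apply: bmeasM => //; exact: bmeas_cst.
(* [g1] has integral 0: the expected regret is minus the pairing of the adversary's parameter with
   [mean_gap], and [f1] restores it by unbiasedness. *)
pose g1 x := inst h x + f1 x.
have bg1 : bmeas g1 by apply: bmeasD => //; exact: bmeas_inst.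
pose g2 x := f2 x + K.
have bg2 : bmeas g2 by apply: bmeasD => //; exact: bmeas_cst.
have [_ [B HB]] := bmeasD bg1 bg2.
have lF x : - m.+1%:R <= F x.
  apply: (@le_trans _ _ (\sum_b piB x b * (- m.+1%:R))).
    by rewrite -mulr_suml b1 mul1r.
  apply: ler_sum => b _; apply: ler_wpM2l => //.
  apply: (@le_trans _ _ (\sum_a pil h x a * (- m.+1%:R))).
    by rewrite -mulr_suml pil_sum1 mul1r.
  apply: ler_sum => a _; apply: ler_wpM2l; first exact: pil_ge0.
  have /andP[+ _] := ih (rcons h (x, b, a)).
  have /andP[+ _] := inst_bounds h x.
  by rewrite -[m.+1]addn1 natrD => h1 h2; lra.
(* The bound of [potential_step] is the same for every learner action [a], so averaging over [a]
   leaves it unchanged. *)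
have uF x : F x <= g1 x + g2 x.
  have -> : g1 x + g2 x = \sum_b piB x b *
      (inst h x + dotv (estimate h x b) (mean_gap h)
        + eta * estimate_moment x b + K).
    under [RHS]eq_bigr do rewrite !mulrDr.
    rewrite !big_split/= -!mulr_suml b1 !mul1r /g1 /g2 /f1 /f2 mulr_sumr !addrA.
    by congr (_ + _ + _ + _); apply: eq_bigr => b _; rewrite mulrCA.
  apply: ler_sum => b _; apply: ler_wpM2l => //.
  rewrite -[leRHS]mul1r -(pil_sum1 h x) mulr_suml.
  apply: ler_sum => a _; apply: ler_wpM2l; first exact: pil_ge0.
  have /andP[_ +] := ih (rcons h (x, b, a)).
  by have := potential_step h x b a; rewrite /K => h1 h2; lra.
apply/andP; split.
  rewrite -[leLHS](Rintegral_cstP D).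
  apply: (@le_Rintegral_bounded _ _ _ _ _ _ (- m.+1%:R) B) => // x.
  by apply: le_trans (uF x) _; apply: le_trans (ler_norm _) (HB x).
apply: (@le_trans _ _ (Rintegral D setT (fun x => g1 x + g2 x))).
  apply: (@le_Rintegral_bounded _ _ _ _ _ _ (- m.+1%:R) B) => // x.
  exact: le_trans (ler_norm _) (HB x).
rewrite (Rintegral_bmeasD _ bg1 bg2) (Rintegral_bmeasD _ (bmeas_inst h) bf1).
rewrite (Rintegral_bmeasD _ bf2 (bmeas_cst _ K)) (Rintegral_bmeasZ _ _ bq).
rewrite Rintegral_inst Rintegral_estimate
  Rintegral_estimate_moment Rintegral_cstP -/C /K.
by rewrite addNr add0r -[m.+1]addn1 natrD; lra.
Qed.

Lemma potential_nil : potential [::] = ln #|A|%:R / eta.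
Proof.
rewrite /potential; congr (_ / _).
rewrite -[RHS](Rintegral_cstP D); congr Rintegral.
have w1 x a : w [::] x a = 1 by rewrite /weight big_ord0.
apply/funext => x; rewrite /log_potential; under eq_bigr do rewrite w1.
rewrite sumr_const big1 ?subr0// => a _; by rewrite w1 ln1 mulr0.
Qed.

Lemma exp_regret_bounds n :
  - n%:R <= exp_regret_from D phi adv piB pistar eta u n [::] <=
  ln #|A|%:R / eta + eta * n%:R * Cphi D phi pistar piB.
Proof.
by rewrite -potential_nil -mulrA mulrCA; exact: exp_regret_from_bounds.
Qed.

End Game.

(** Positivity of the square root forces [L / m > 0], hence [L] and [m] are positive and every
    division is genuine. It is used with [m = n] and with [m = C * n]. *)
Lemma sqrt_tuning (R : realType) (L m : R) : 0 <= L ->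
  0 < Num.sqrt (L / m) ->
  L / Num.sqrt (L / m) = Num.sqrt (m * L) /\
  Num.sqrt (L / m) * m = Num.sqrt (m * L).
Proof.
move=> L0 e0; have Lm : 0 < L / m by rewrite -sqrtr_gt0.
have Lp : 0 < L.
  by rewrite lt_def L0 andbT; apply: contraTneq Lm => ->; rewrite mul0r ltxx.
have mp : 0 < m by rewrite -invr_gt0 -(pmulr_rgt0 _ Lp).
have m0 : m != 0 by rewrite gt_eqF.
have eL : Num.sqrt (L / m) * Num.sqrt (m * L) = L.
  rewrite -sqrtrM ?(ltW Lm)// (_ : L / m * (m * L) = L ^+ 2); last by field.
  by rewrite sqrtr_sqr ger0_norm.
split; first by rewrite -{1}eL mulrAC divff ?mul1r// gt_eqF.
rewrite -{2}(ger0_norm (ltW mp)) -sqrtr_sqr -sqrtrM ?(ltW Lm)//.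
by congr Num.sqrt; field.
Qed.

(** * The regret bound and its two tuned forms *)

Unset Implicit Arguments.

Theorem theorem3 (R : realType) (d : nat)
  (dT : measure_display) (T : measurableType dT) (D : probability T R)
  (A : finType) (phi : T -> A -> 'cV[R]_d)
  (dU : measure_display) (U : measurableType dU) (Q : probability U R)
  (adv : U -> hist T A -> 'cV[R]_d)
  (piB pistar : T -> A -> R) (n : nat) :
  (forall a i, measurable_fun setT (fun x => phi x a i 0)) ->
  (forall (t : nat) (ba : t.-tuple (A * A)) i,
      measurable_fun setT
        (fun p : U * t.-tuple T => adv p.1 (mkhist (val p.2) (val ba)) i 0)) ->
  (forall u h x a, 0 <= dotv (adv u h) (phi x a) <= 1) ->
  is_policy piB -> is_policy pistar ->
  Vbar D phi piB \in unitmx ->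
  let K := #|A| in
  let C := Cphi D phi pistar piB in
  (forall eta : R, 0 < eta -> eta_condition D phi piB eta ->
     expected_regret D phi Q adv piB pistar eta n
       <= ln K%:R / eta + eta * n%:R * C) /\
  (let eta := Num.sqrt (ln K%:R / n%:R) in
   0 < eta -> eta_condition D phi piB eta ->
     expected_regret D phi Q adv piB pistar eta n
       <= Num.sqrt (n%:R * ln K%:R) * (1 + C)) /\
  (let eta := Num.sqrt (ln K%:R / (C * n%:R)) in
   0 < eta -> eta_condition D phi piB eta ->
     expected_regret D phi Q adv piB pistar eta n
       <= 2 * Num.sqrt (C * n%:R * ln K%:R)).
Proof.
move=> mphi _ adv01 polB polS Vu K C.
have main (eta : R) : 0 < eta -> eta_condition D phi piB eta ->
    expected_regret D phi Q adv piB pistar eta n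
      <= ln K%:R / eta + eta * n%:R * C.
  (* The bound is uniform in the adversary's seed, so it survives averaging over [Q]. *)
  move=> eta0 etac; rewrite -[leRHS](Rintegral_cstP Q).
  apply: (@le_Rintegral_bounded _ _ _ _ _ _ (- n%:R)
    (ln K%:R / eta + eta * n%:R * C)) => // u;
    by have /andP[] := exp_regret_bounds mphi (adv01 u) polB polS Vu eta0 etac n.
have L0 : 0 <= ln K%:R :> R.
  by rewrite /K; case: #|A| => [|k]; [rewrite ln0|rewrite ln_ge0// ler1n].
split=> //; split=> eta eta0 etac; apply: le_trans (main eta eta0 etac) _.
  have [-> ->] := sqrt_tuning L0 eta0.
  by rewrite mulrDr mulr1.
(* Here [m = C * n], and both terms of the bound equal the same square root. *)
have [E1 E2] := sqrt_tuning L0 eta0.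
by rewrite -mulrA [n%:R * C]mulrC E1 E2 -mulr2n mulr_natl.
Qed.
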